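(* If $R$ is a central reduced ring, then the trivial extension $T(R,R)$ is central Armendariz.
   Context: All rings are associative with identity, not necessarily commutative. A ring $R$ is called central reduced if every nilpotent element of $R$ is central. The trivial extension $T(R,R)$ is the ring $R\oplus R$ with componentwise addition and multiplication $(r_1,m_1)(r_2,m_2)=(r_1r_2,\ r_1m_2+m_1r_2)$; equivalently, it is the ring of matrices $\begin{bmatrix} r&m\\ 0&r\end{bmatrix}$ with $r,m\in R$ under the usual matrix operations. A ring $S$ is called central Armendariz if whenever $f(x)=\sum_{i=0}^n a_ix^i$ and $g(x)=\sum_{j=0}^s b_jx^j$ in $S[x]$ satisfy $f(x)g(x)=0$, then $a_ib_j$ is a central element of $S$ for all $i$ and $j$. *)

(* Defs.v *)
From HB Require Import structures.
From mathcomp Require Import all_boot all_algebra.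

Set Implicit Arguments.
Unset Strict Implicit.
Unset Printing Implicit Defensive.

Import GRing.Theory.
Local Open Scope ring_scope.

Definition central (R : pzRingType) (a : R) : Prop :=
  forall x : R, GRing.comm a x.

Definition nilpotent_elt (R : pzRingType) (a : R) : Prop :=
  exists n : nat, a ^+ n = 0.

Definition central_reduced (R : pzRingType) : Prop :=
  forall a : R, nilpotent_elt a -> central a.

(* Coefficients beyond the degree are 0, hence trivially central, so i and j
   may range over all natural numbers. *)
Definition central_armendariz (S : nzRingType) : Prop :=
  forall f g : {poly S}, f * g = 0 ->
  forall i j : nat, central (f`_i * g`_j).

(* T(R, R).  An alias of R * R is needed because the product type itself
   carries the componentwise multiplication. *)
Definition trivext (R : Type) : Type := (R * R)%type.

HB.instance Definition _ (R : pzRingType) :=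
  GRing.Zmodule.copy (trivext R) (R * R)%type.

Section TrivialExtension.
Variable R : pzRingType.
Implicit Types u v w : trivext R.

Definition trivext_one : trivext R := (1, 0).
Definition trivext_mul u v : trivext R :=
  (u.1 * v.1, u.1 * v.2 + u.2 * v.1).

Lemma trivext_mulA : associative trivext_mul.
Proof.
move=> u v w; congr pair; first exact: mulrA.
by rewrite /= mulrDr mulrDl !mulrA addrA.
Qed.

Lemma trivext_mul1l : left_id trivext_one trivext_mul.
Proof. by case=> r m; rewrite /trivext_mul /= !mul1r mul0r addr0. Qed.

Lemma trivext_mul1r : right_id trivext_one trivext_mul.
Proof. by case=> r m; rewrite /trivext_mul /= !mulr1 mulr0 add0r. Qed.

Lemma trivext_mulDl : left_distributive trivext_mul +%R.
Proof.
by move=> u v w; congr pair; rewrite /= !mulrDl // addrACA.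
Qed.

Lemma trivext_mulDr : right_distributive trivext_mul +%R.
Proof.
by move=> u v w; congr pair; rewrite /= !mulrDr // addrACA.
Qed.

HB.instance Definition _ := GRing.Zmodule_isPzRing.Build (trivext R)
  trivext_mulA trivext_mul1l trivext_mul1r trivext_mulDl trivext_mulDr.

End TrivialExtension.

Lemma trivext_oner_neq0 (R : nzRingType) : (1 : trivext R) != 0.
Proof. by apply/eqP => -[/eqP]; rewrite oner_eq0. Qed.

HB.instance Definition _ (R : nzRingType) :=
  GRing.PzSemiRing_isNonZero.Build (trivext R) (@trivext_oner_neq0 R).

(* Main.v *)
(** In a central reduced ring R the nilpotent elements form an ideal N, and R/N
is reduced.  Write the coefficients of f and g as (a_i, a'_i) and (b_j, b'_j);
fg = 0 says that the convolutions ab and ab' + a'b vanish.  The Armendariz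
argument for reduced rings, carried out modulo N, gives a_i b_j in N, hence
b_j r a_i in N for every r.  Therefore the square of a'b = -ab' vanishes modulo
N coefficientwise, so a'b and ab' vanish modulo N and the Armendariz argument
applies to them as well.  All entries of the products of coefficients are thus
nilpotent, hence central. *)

Require Import Defs.
From mathcomp Require Import all_boot all_algebra.
From mathcomp Require Import zify.

Set Implicit Arguments.
Unset Strict Implicit.
Unset Printing Implicit Defensive.

Import GRing.Theory.
Local Open Scope ring_scope.

Lemma nilpotent_elt0 (R : pzRingType) : nilpotent_elt (0 : R).
Proof. by exists 1%N. Qed.

Lemma nilpotent_eltN (R : pzRingType) (a : R) :
  nilpotent_elt a -> nilpotent_elt (- a).
Proof. by case=> n an0; exists n; rewrite exprNn an0 mulr0. Qed.

Lemma nilpotent_elt_sqr (R : pzRingType) (a : R) :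
  nilpotent_elt (a * a) -> nilpotent_elt a.
Proof. by case=> n aan0; exists (2 * n)%N; rewrite exprM expr2. Qed.

Lemma nilpotent_eltC (R : pzRingType) (a b : R) :
  nilpotent_elt (a * b) -> nilpotent_elt (b * a).
Proof.
case=> n abn0; exists n.+1.
suff -> : (b * a) ^+ n.+1 = b * (a * b) ^+ n * a by rewrite abn0 mulr0 mul0r.
elim: n {abn0} => [|n IHn]; first by rewrite expr1 expr0 mulr1.
by rewrite exprS IHn [(a * b) ^+ n.+1]exprS !mulrA.
Qed.

Section CentralReduced.
Context (R : pzRingType) (redR : central_reduced R).
Implicit Types a b r : R.

Lemma nilpotent_eltMl r a : nilpotent_elt a -> nilpotent_elt (r * a).
Proof.
move=> nila; have [n an0] := nila; exists n.
by rewrite exprMn_comm ?an0 ?mulr0 //; apply/commr_sym/redR.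
Qed.

Lemma nilpotent_eltMr r a : nilpotent_elt a -> nilpotent_elt (a * r).
Proof. by move=> nila; apply/nilpotent_eltC/nilpotent_eltMl. Qed.

Lemma nilpotent_eltD a b :
  nilpotent_elt a -> nilpotent_elt b -> nilpotent_elt (a + b).
Proof.
move=> nila [m bm0]; have [n an0] := nila; exists (n + m)%N.
(* The binomial formula applies since [a] is central; each term has [b] to a power at least [m] or
   [a] to a power at least [n]. *)
rewrite exprDn_comm; last exact: redR.
rewrite big1 // => i _; have [le_mi | lt_im] := leqP m i.
  by rewrite -(subnK le_mi) exprD bm0 !mulr0 mul0rn.
have -> : (n + m - i = n + (m - i))%N by lia.
by rewrite exprD an0 !mul0r mul0rn.
Qed.

Lemma nilpotent_elt_sum (I : Type) (s : seq I) (P : pred I) (F : I -> R) :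
  (forall i, P i -> nilpotent_elt (F i)) ->
  nilpotent_elt (\sum_(i <- s | P i) F i).
Proof.
by apply: big_ind => [|a b]; [exact: nilpotent_elt0 | exact: nilpotent_eltD].
Qed.

(** The square of [a * r * b] contains the nilpotent factor [b * a]. *)
Lemma nilpotent_elt_mid r a b :
  nilpotent_elt (a * b) -> nilpotent_elt (a * r * b).
Proof.
move=> /nilpotent_eltC nilba; apply: nilpotent_elt_sqr.
have -> : a * r * b * (a * r * b) = a * r * (b * a) * (r * b).
  by rewrite !mulrA.
exact/nilpotent_eltMr/nilpotent_eltMl.
Qed.

(** Armendariz argument modulo nilpotents: strong induction on [k = i + j], then on [i] for fixed
    [k]. *)
Lemma nilpotent_elt_conv (a b : nat -> R) :
  (forall k, nilpotent_elt (\sum_(i < k.+1) a i * b (k - i)%N)) ->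
  forall i j, nilpotent_elt (a i * b j).
Proof.
move=> nilconv i j.
have [k] := ubnPeq (i + j)%N; elim/ltn_ind: k i j => k IHk i.
elim/ltn_ind: i => i IHi j def_k.
have lt_ik : (i < k.+1)%N by lia.
(* Modulo the nilpotents, multiplying the k-th coefficient by [a i] on the left
   leaves only [a i * a i * b j]. *)
have nilaab : nilpotent_elt (a i * (a i * b j)).
  have := nilpotent_eltMl (a i) (nilconv k).
  rewrite (bigD1 (Ordinal lt_ik)) //= mulrDr.
  have -> : (k - i = j)%N by lia.
  set s := \sum_(_ < _ | _) _ => nil_all.
  suff /nilpotent_eltN/(nilpotent_eltD nil_all) : nilpotent_elt (a i * s).
    by rewrite addrK.
  rewrite mulr_sumr; apply: nilpotent_elt_sum => l.
  rewrite -val_eqE /= => neq_li.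
  have lt_lk := ltn_ord l.
  (* For [l < i] the inner induction applies. For [l > i] the index sum [i + (k - l)] is below [k],
     so [a i * b (k - l)] is nilpotent and stays so with [a l] inserted. *)
  have [lt_li | le_il] := ltnP l i.
    by apply/nilpotent_eltMl/(IHi _ lt_li); lia.
  by rewrite mulrA; apply/nilpotent_elt_mid/(IHk (i + (k - l))%N); lia.
(* The square starts with [a i * b j * a i], a cyclic rotation of [nilaab]. *)
apply: nilpotent_elt_sqr; rewrite mulrA.
exact/nilpotent_eltMr/nilpotent_eltC.
Qed.

Lemma nilpotent_elt_conv_cross (a a' b b' : nat -> R) :
  (forall k, \sum_(i < k.+1) a i * b (k - i)%N = 0) ->
  (forall k, \sum_(i < k.+1) (a i * b' (k - i)%N + a' i * b (k - i)%N) = 0) ->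
  forall i j, [/\ nilpotent_elt (a i * b j), nilpotent_elt (a i * b' j)
                & nilpotent_elt (a' i * b j)].
Proof.
move=> conv0 conv'0.
have nilab : forall i j, nilpotent_elt (a i * b j).
  by apply: nilpotent_elt_conv => k; rewrite conv0; exact: nilpotent_elt0.
have convN k : \sum_(i < k.+1) a i * b' (k - i)%N =
               - \sum_(i < k.+1) a' i * b (k - i)%N.
  by apply/eqP; rewrite -addr_eq0 -big_split; apply/eqP/conv'0.
have nilconv' k : nilpotent_elt (\sum_(i < k.+1) a' i * b (k - i)%N).
  apply: nilpotent_elt_sqr; rewrite -[X in _ * X]opprK -convN mulrN.
  apply: nilpotent_eltN; rewrite mulr_suml.
  apply: nilpotent_elt_sum => i _; rewrite mulr_sumr.
  apply: nilpotent_elt_sum => j _.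
  (* The middle factor is some [b _ * a j], nilpotent by [nilab] and rotation. *)
  rewrite mulrA -(mulrA (a' i)).
  exact/nilpotent_eltMr/nilpotent_eltMl/nilpotent_eltC.
move=> i j; split=> //; apply: nilpotent_elt_conv => // k.
by rewrite convN; apply/nilpotent_eltN/nilconv'.
Qed.

Lemma central_trivext (u : trivext R) :
  nilpotent_elt u.1 -> nilpotent_elt u.2 -> central u.
Proof.
move=> /redR cu1 /redR cu2 v; congr pair => /=; first exact: cu1.
by rewrite addrC cu1 cu2.
Qed.

End CentralReduced.

Lemma trivext_sum (R : pzRingType) (I : Type) (s : seq I) (P : pred I)
    (F : I -> trivext R) :
  \sum_(i <- s | P i) F i =
  (\sum_(i <- s | P i) (F i).1, \sum_(i <- s | P i) (F i).2) :> trivext R.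
Proof. by elim/big_rec3: _ => // i x y z _ ->. Qed.

Theorem theorem2p34 (R : nzRingType) :
  central_reduced R -> central_armendariz (trivext R).
Proof.
move=> redR f g fg0 i j.
have conv0 k : \sum_(l < k.+1) f`_l * g`_(k - l) = 0.
  by rewrite -coefM fg0 coef0.
have [|k|nil_1 nil_2 nil_3] := nilpotent_elt_conv_cross redR
    (a := fun l => (f`_l).1) (a' := fun l => (f`_l).2)
    (b := fun l => (g`_l).1) (b' := fun l => (g`_l).2) _ _ i j.
- by move=> k; have := conv0 k; rewrite trivext_sum => -[].
- by have := conv0 k; rewrite trivext_sum => -[].
(* The second entry of the product is the sum of the two cross terms. *)
by apply: central_trivext => //; apply: nilpotent_eltD.
Qed.
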